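(* Let $G_f=(\mu_V,\mu_E)$ be a fuzzy graph on node set $V$, let $\alpha\in(0,1]$, and let the edge $e=uv$ be contracted to $w$ using a $t$-norm $T$. For any $x\in V\setminus\{u,v\}$, if $\mu_E(ux)<\alpha$ or $\mu_E(vx)<\alpha$ then $\mu'_E(wx)<\alpha$. Equivalently, \[ N^{(\alpha)}_{G_f/e}(w)=N^{(\alpha)}_{G_f}(u)\cap N^{(\alpha)}_{G_f}(v), \] where $N^{(\alpha)}_{G_f}(u)=\{x:\mu_E(ux)\ge\alpha\}$ is the $\alpha$-neighborhood.
   Context: A fuzzy graph is a pair $G_f=(\mu_V,\mu_E)$ with node membership $\mu_V:V\to[0,1]$ and edge membership $\mu_E(u,v)\in[0,1]$ (undirected edges), with $\mu_E(u,v)\le\min\{\mu_V(u),\mu_V(v)\}$. Fuzzy contraction: for an edge $e=uv$, $G_f/e$ has node set $(V\setminus\{u,v\})\cup\{w\}$, with $\mu(w)=\min\{\mu_V(u),\mu_V(v)\}$ (or an appropriate $t$-norm of these two values), and edge memberships $\mu'_E$ given by $\mu'_E(wx)=T(\mu_E(ux),\mu_E(vx))$ for every $x\in V\setminus\{u,v\}$, where $T:[0,1]^2\to[0,1]$ is a $t$-norm (commonly the minimum); all other memberships are unchanged.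
   Formalization: The neighborhood equality fails for a general t-norm (product, triangle with all edges 1/2, α=1/2), so it is stated only when T(α,α)=α (always so for the minimum); for every T the inclusion ⊆ and the first claim are kept. Graphs are taken without loops. *)

(* Defs.v *)
From HB Require Import structures.
From mathcomp Require Import all_boot all_order all_algebra.
From mathcomp Require Import boolp classical_sets reals.
Set Implicit Arguments.
Unset Strict Implicit.
Unset Printing Implicit Defensive.
Import Order.TTheory GRing.Theory Num.Theory.
Local Open Scope classical_set_scope.
Local Open Scope ring_scope.

Definition unit_itv (R : realType) (a : R) : Prop := 0 <= a <= 1.

(* A t-norm is an operation on [0, 1]; here it is the restriction to [0, 1] of
   a total function on R, whose values elsewhere are irrelevant. *)
Record tnorm (R : realType) (T : R -> R -> R) : Prop := Tnorm {
  tnorm_unit : forall a b, unit_itv a -> unit_itv b -> unit_itv (T a b);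
  tnormC : forall a b, unit_itv a -> unit_itv b -> T a b = T b a;
  tnormA : forall a b c, unit_itv a -> unit_itv b -> unit_itv c ->
    T a (T b c) = T (T a b) c;
  tnorm_le : forall a b c d, unit_itv a -> unit_itv b -> unit_itv c ->
    unit_itv d -> a <= c -> b <= d -> T a b <= T c d;
  tnorm1 : forall a, unit_itv a -> T a 1 = a }.

(* The node set is a subset of an ambient type U, so that a graph and its
   contraction, whose node sets differ, have neighborhoods of the same type.
   The membership functions are meaningful only on the node set. *)
Record fuzzy_data (R : realType) (U : eqType) := FuzzyData {
  nodes : set U;
  node_mem : U -> R;
  edge_mem : U -> U -> R }.

(* Edges are unordered pairs of distinct nodes: edge_mem is symmetric and
   vanishes on the diagonal. *)
Record is_fuzzy_graph (R : realType) (U : eqType) (G : fuzzy_data R U) : Prop :=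
  IsFuzzyGraph {
  node_mem_unit : forall x, nodes G x -> unit_itv (node_mem G x);
  edge_mem_unit : forall x y, nodes G x -> nodes G y ->
    unit_itv (edge_mem G x y);
  edge_memC : forall x y, nodes G x -> nodes G y ->
    edge_mem G x y = edge_mem G y x;
  edge_mem_loop : forall x, nodes G x -> edge_mem G x x = 0;
  edge_mem_le : forall x y, nodes G x -> nodes G y ->
    edge_mem G x y <= Num.min (node_mem G x) (node_mem G y) }.

Definition fuzzy_edge (R : realType) (U : eqType) (G : fuzzy_data R U)
    (u v : U) : Prop :=
  [/\ nodes G u, nodes G v, u != v & 0 < edge_mem G u v].

(* S combines the memberships of u and v (the minimum, or another t-norm),
   T those of the edges ux and vx. *)
Definition contract (R : realType) (U : eqType) (S T : R -> R -> R)
    (G : fuzzy_data R U) (u v w : U) : fuzzy_data R U :=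
  {| nodes := (nodes G `\` [set u; v]) `|` [set w];
     node_mem := fun x =>
       if x == w then S (node_mem G u) (node_mem G v) else node_mem G x;
     edge_mem := fun x y =>
       if x == w then
         if y == w then 0 else T (edge_mem G u y) (edge_mem G v y)
       else if y == w then T (edge_mem G u x) (edge_mem G v x)
       else edge_mem G x y |}.

Definition alpha_nbhd (R : realType) (U : eqType) (G : fuzzy_data R U)
    (alpha : R) (x : U) : set U :=
  [set y | nodes G y /\ alpha <= edge_mem G x y].

Lemma tnorm_le_min (R : realType) (T : R -> R -> R) (a b : R) :
  tnorm T -> unit_itv a -> unit_itv b -> T a b <= Num.min a b.
Proof.
move=> hT ha hb; have h1 : unit_itv (1 : R) by rewrite /unit_itv ler01 lexx.
have [/andP[_ a1] /andP[_ b1]] := (ha, hb).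
rewrite le_min; apply/andP; split.
- by rewrite -[leRHS](tnorm1 hT ha); apply: (tnorm_le hT).
- by rewrite (tnormC hT ha hb) -[leRHS](tnorm1 hT hb); apply: (tnorm_le hT).
Qed.

Lemma tnorm_min (R : realType) : tnorm (fun a b : R => Num.min a b).
Proof.
split.
- move=> a b /andP[a0 a1] /andP[b0 b1]; rewrite /unit_itv le_min a0 b0 /=.
  by rewrite ge_min a1.
- by move=> a b _ _; rewrite minC.
- by move=> a b c _ _ _; rewrite minA.
- by move=> a b c d _ _ _ _ ac bd; rewrite le_min !ge_min ac bd orbT.
- by move=> a /andP[_ a1]; exact/min_idPl.
Qed.

(* The contraction is a fuzzy graph as soon as T <= S on [0, 1], in particular
   for S the minimum and for S = T. *)
Lemma contract_fuzzy_graph (R : realType) (U : eqType) (S T : R -> R -> R)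
    (G : fuzzy_data R U) (u v w : U) :
  is_fuzzy_graph G -> tnorm S -> tnorm T ->
  (forall a b, unit_itv a -> unit_itv b -> T a b <= S a b) ->
  fuzzy_edge G u v -> ~ (nodes G `\` [set u; v]) w ->
  is_fuzzy_graph (contract S T G u v w).
Proof.
move=> hG hS hT leTS [Gu Gv _ _] hw.
have nE x : nodes (contract S T G u v w) x -> x != w -> nodes G x.
  by case=> [[]//|/= ->]; rewrite eqxx.
have bound x : nodes G x -> T (edge_mem G u x) (edge_mem G v x) <=
    Num.min (S (node_mem G u) (node_mem G v)) (node_mem G x).
  move=> Gx; have eu := edge_mem_unit hG Gu Gx.
  have ev := edge_mem_unit hG Gv Gx.
  have := edge_mem_le hG Gu Gx; have := edge_mem_le hG Gv Gx.
  rewrite !le_min => /andP[vv vx] /andP[uu ux]; apply/andP; split.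
    apply: le_trans (leTS _ _ _ _) _ => //.
    by apply: (tnorm_le hS) => //; exact: (node_mem_unit hG).
  apply: le_trans ux; apply: le_trans (tnorm_le_min hT eu ev) _.
  by rewrite ge_min lexx.
split.
- move=> x /= hx; case: ifPn => [_|xw]; last exact/(node_mem_unit hG)/nE.
  by apply: (tnorm_unit hS); exact: (node_mem_unit hG).
- move=> x y hx hy /=; case: ifPn => [_|/(nE _ hx) Gx];
    case: ifPn => [_|/(nE _ hy) Gy].
  + by rewrite /unit_itv lexx ler01.
  + by apply: (tnorm_unit hT); exact: (edge_mem_unit hG).
  + by apply: (tnorm_unit hT); exact: (edge_mem_unit hG).
  + exact: (edge_mem_unit hG).
- move=> x y hx hy /=; case: ifPn => [_|/(nE _ hx) Gx];
    case: ifPn => [_|/(nE _ hy) Gy] //.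
  exact: (edge_memC hG).
- move=> x hx /=; case: (boolP (x == w)) => // /(nE _ hx) Gx.
  exact: (edge_mem_loop hG).
- move=> x y hx hy /=; case: ifPn => [_|/(nE _ hx) Gx];
    case: ifPn => [_|/(nE _ hy) Gy].
  + rewrite minxx; have := tnorm_unit hS (node_mem_unit hG Gu) (node_mem_unit hG Gv).
    by case/andP.
  + exact: bound.
  + by rewrite minC; exact: bound.
  + exact: (edge_mem_le hG).
Qed.

(* Main.v *)
Require Import Defs.
From HB Require Import structures.
From mathcomp Require Import all_boot all_order all_algebra.
From mathcomp Require Import boolp classical_sets reals.
Set Implicit Arguments.
Unset Strict Implicit.
Unset Printing Implicit Defensive.
Import Order.TTheory GRing.Theory Num.Theory.
Local Open Scope classical_set_scope.
Local Open Scope ring_scope.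

(** A t-norm lies below the minimum ([tnorm_le_min]): [T a b <= T a 1 = a], and
    symmetrically for [b]. So the edge from [w] to [x], of strength
    [T (ux) (vx)], reaches the level [alpha] only if both [ux] and [vx] do:
    this is the inequality, and the inclusion of the neighborhood of [w] in the
    intersection.

    The reverse inclusion asks that [T a b >= alpha] whenever [a] and [b] are at
    least [alpha]. By monotonicity this follows from [T alpha alpha = alpha],
    which holds at every level for the minimum; the product, with
    [T alpha alpha = alpha ^ 2], violates it for [0 < alpha < 1].

    The rest is about which nodes may occur. Since [alpha > 0] and there are no
    loops, [u] is not in its own [alpha]-neighborhood, nor [v] in its own, nor
    [w] in its own; hence both sides of the equality consist of nodes that the
    contraction leaves in place. *)

Lemma tnorm_ge_both (R : realType) (T : R -> R -> R) (alpha a b : R) :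
  tnorm T -> unit_itv a -> unit_itv b ->
  alpha <= T a b -> alpha <= a /\ alpha <= b.
Proof.
move=> hT ha hb /le_trans/(_ (tnorm_le_min hT ha hb)).
by rewrite le_min => /andP[].
Qed.

(** The superlevel set of a t-norm at an idempotent level is a square, because
    [(alpha, alpha)] is then its least point. *)
Lemma tnorm_idem_le (R : realType) (T : R -> R -> R) (alpha a b : R) :
  tnorm T -> unit_itv alpha -> unit_itv a -> unit_itv b ->
  T alpha alpha = alpha -> alpha <= a -> alpha <= b -> alpha <= T a b.
Proof. by move=> hT h ha hb idem la lb; rewrite -idem; apply: (tnorm_le hT). Qed.

Lemma edge_mem_contract_new (R : realType) (U : eqType) (S T : R -> R -> R)
    (G : fuzzy_data R U) (u v w x : U) :
  x != w ->
  edge_mem (contract S T G u v w) w x = T (edge_mem G u x) (edge_mem G v x).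
Proof. by move=> /negbTE xw /=; rewrite eqxx xw. Qed.

(** At a positive level the new node drops out of its own neighborhood, its loop
    having membership 0. *)
Lemma alpha_nbhd_contract_new (R : realType) (U : eqType) (S T : R -> R -> R)
    (G : fuzzy_data R U) (alpha : R) (u v w : U) :
  0 < alpha -> ~ (nodes G `\` [set u; v]) w ->
  alpha_nbhd (contract S T G u v w) alpha w =
  [set x | (nodes G `\` [set u; v]) x /\
           alpha <= T (edge_mem G u x) (edge_mem G v x)].
Proof.
move=> alpha0 hw; apply/seteqP; split=> x.
- case=> Gx ex; have [xw|xw] := eqVneq x w.
    by move: ex; rewrite xw /= eqxx leNgt alpha0.
  move: ex; rewrite edge_mem_contract_new // => ex; split=> //.
  by case: Gx => // /= /eqP; rewrite (negbTE xw).
- case=> Gx ex; have xw : x != w by apply/eqP => xw; apply: hw; rewrite -xw.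
  by split; [left | rewrite edge_mem_contract_new].
Qed.

Lemma alpha_nbhd_irrefl (R : realType) (U : eqType) (G : fuzzy_data R U)
    (alpha : R) (x : U) :
  is_fuzzy_graph G -> 0 < alpha -> ~ alpha_nbhd G alpha x x.
Proof.
by move=> hG alpha0 [Gx]; rewrite (edge_mem_loop hG Gx) leNgt alpha0.
Qed.

Theorem theorem3p7 (R : realType) (U : eqType) (G : fuzzy_data R U)
    (S T : R -> R -> R) (alpha : R) (u v w : U)
    (hG : is_fuzzy_graph G) (hS : tnorm S) (hT : tnorm T)
    (halpha : 0 < alpha <= 1) (he : fuzzy_edge G u v)
    (hw : ~ (nodes G `\` [set u; v]) w) :
  [/\ (forall x : U, (nodes G `\` [set u; v]) x ->
         edge_mem G u x < alpha \/ edge_mem G v x < alpha ->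
         edge_mem (contract S T G u v w) w x < alpha),
      alpha_nbhd (contract S T G u v w) alpha w `<=`
        alpha_nbhd G alpha u `&` alpha_nbhd G alpha v
    & T alpha alpha = alpha ->
      alpha_nbhd (contract S T G u v w) alpha w =
        alpha_nbhd G alpha u `&` alpha_nbhd G alpha v].
Proof.
have [Gu Gv _ _] := he; have /andP[alpha0 alpha1] := halpha.
have eu x : nodes G x -> unit_itv (edge_mem G u x) by exact: (edge_mem_unit hG).
have ev x : nodes G x -> unit_itv (edge_mem G v x) by exact: (edge_mem_unit hG).
have sub : alpha_nbhd (contract S T G u v w) alpha w `<=`
    alpha_nbhd G alpha u `&` alpha_nbhd G alpha v.
  rewrite alpha_nbhd_contract_new // => x [[Gx _]].
  by move=> /(tnorm_ge_both hT (eu _ Gx) (ev _ Gx))[].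
split=> // [x Gx small|idem].
- rewrite ltNge; apply/negP => ex.
  have [|[_ lu] [_ lv]] := sub x; first by split; first left.
  by case: small; rewrite ltNge ?lu ?lv.
- apply/seteqP; split=> // x [Nu Nv]; have [[Gx lu] [_ lv]] := (Nu, Nv).
  rewrite alpha_nbhd_contract_new //; split; last first.
    by apply: tnorm_idem_le => //; [rewrite /unit_itv ltW | exact: eu | exact: ev].
  by split=> // -[] /= xE; [move: Nu|move: Nv]; rewrite xE;
    exact: alpha_nbhd_irrefl.
Qed.
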